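(* Let $d, D \in \mathbb{N}$ with $d>1$, and let $\{\alpha_n\}_{n\ge 1}$ be a sequence of real and positive algebraic integers with $\max_{n} \deg \alpha_n = d$, such that $|\alpha_n| = h(\alpha_n)$ for all $n$, where $h(\alpha_n)$ denotes the house of $\alpha_n$, and such that $$ \limsup_{n \rightarrow \infty} h(\alpha_n)^{\frac{1}{D d^{n-1} \prod_{i=1}^{n-2}(D d^i + 1)}} = \infty. $$ Let $\alpha$ be given by the continued fraction $\alpha=[0;\alpha_1,\alpha_2,\dots]$. Then $$ \deg(\alpha) > D, $$ i.e. $\alpha$ is not an algebraic number of degree less than or equal to $D$.
   Context: Degrees are over $\mathbb{Q}$. For an algebraic number $\beta$ with conjugates $\beta_1=\beta,\beta_2,\dots,\beta_m$ (over $\mathbb{Q}$), the house of $\beta$ is $h(\beta) = \max_{1\le j\le m} |\beta_j|$. The inequality $\deg(\alpha) > D$ means that $\alpha$ is not an algebraic number of degree at most $D$ (so $\alpha$ may be transcendental). Empty products equal $1$. The continued fraction $[0;\alpha_1,\alpha_2,\dots]$ denotes $$\cfrac{1}{\alpha_1 + \cfrac{1}{\alpha_2+\cfrac{1}{\ddots}}},$$ that is, the limit as $n\to\infty$ of the convergents $p_n/q_n = [0;\alpha_1,\dots,\alpha_n]$, where $q_0=1$, $q_1=\alpha_1$, $q_{n+2}=\alpha_{n+2}q_{n+1}+q_n$ and $p_0=0$, $p_1=1$, $p_{n+2}=\alpha_{n+2}p_{n+1}+p_n$. *)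

(* Defs.v *)
From HB Require Import structures.
From mathcomp Require Import all_boot all_order all_algebra.
From mathcomp Require Import all_classical all_reals all_analysis.
From mathcomp.real_closed Require Import complex.
Set Implicit Arguments.
Unset Strict Implicit.
Unset Printing Implicit Defensive.
Import Order.TTheory GRing.Theory Num.Theory.
Import numFieldNormedType.Exports.
Local Open Scope classical_set_scope.
Local Open Scope ring_scope.

Definition is_min_poly (K : fieldType) (x : K) (p : {poly rat}) : Prop :=
  [/\ p \is monic, irreducible_poly p & root (map_poly ratr p) x].

(* In characteristic 0 an algebraic x has exactly one monic irreducible
   annihilating polynomial over rat; the value is 0 when x is transcendental. *)
Definition min_poly (K : fieldType) (x : K) : {poly rat} :=
  xget 0 [set p | is_min_poly x p].

(* The degree over rat of an algebraic x.  Its value is 0 on transcendental x,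
   so it is meaningful only together with [algebraicOver ratr x]. *)
Definition alg_degree (K : fieldType) (x : K) : nat := (size (min_poly x)).-1.

Definition conjugates (R : realType) (z : R[i]) : seq R[i] :=
  sval (closed_field_poly_normal (map_poly ratr (min_poly z) : {poly R[i]})).

Definition house (R : realType) (z : R[i]) : R :=
  \big[Num.max/0]_(w <- conjugates z) ComplexField.Normc.normc w.

(* Partial quotients are a 1, a 2, ...; the value a 0 is not used. *)
Fixpoint cf_num (R : realType) (a : nat -> R) (n : nat) : R :=
  match n with
  | 0 => 0
  | 1 => 1
  | (m.+1 as k).+1 => a n * cf_num a k + cf_num a m
  end.

Fixpoint cf_den (R : realType) (a : nat -> R) (n : nat) : R :=
  match n with
  | 0 => 1
  | 1 => a 1%N
  | (m.+1 as k).+1 => a n * cf_den a k + cf_den a m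
  end.

Definition cont_frac (R : realType) (a : nat -> R) : R :=
  limn (fun n => cf_num a n / cf_den a n).

(* D d^(n-1) prod_{i=1}^{n-2} (D d^i + 1), for n >= 1; the truncated
   subtractions give the empty product when n is 1 or 2. *)
Definition growth_exponent (d D n : nat) : nat :=
  (D * d ^ n.-1 * \prod_(1 <= i < n.-1) (D * d ^ i + 1))%N.

(* Main.v *)
Require Import Defs.
From mathcomp Require Import all_boot all_order all_algebra.
From mathcomp Require Import all_classical all_reals all_analysis.
From mathcomp.real_closed Require Import complex.
From mathcomp Require Import spectral ring lra.
Import Order.TTheory GRing.Theory Num.Theory.
Import numFieldNormedType.Exports.
Local Open Scope classical_set_scope.
Local Open Scope ring_scope.
Set Implicit Arguments.
Unset Strict Implicit.
Unset Printing Implicit Defensive.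

(** The proof is a Liouville argument.  Write [q_n], [p_n] for the continuants
    of [alpha], and suppose that the limit [x] is algebraic of degree at most
    [D]; let [c] be a nonzero integer such that [c x] is an algebraic integer.
    Each [alpha_n] is at least 1, because a positive algebraic integer that
    bounds all its conjugates cannot be smaller than 1 (their product is a
    nonzero integer).  Hence the continued fraction converges, and
    [beta_n = c (q_n x - p_n)] satisfies [0 < |beta_n| <= |c| / q_(n+1)].

    On the other hand [beta_n] is a polynomial with integer coefficients in
    [c x, alpha_1, ..., alpha_n], so it is a root of a monic integer polynomial
    of degree at most [N = D d^n], all of whose roots arise by putting conjugates
    in place of these numbers.  As the continuants have nonnegative coefficients
    and [alpha_i] is equal to its house, every such root has modulus at most
    [M = C q_n], where [C] does not depend on [n].  The product of the nonzero
    roots of a monic integer polynomial is a nonzero integer, so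
    [1 <= |beta_n| M^N] (lemma [continued_fraction_liouville]).

    The two estimates give [q_(n+1) <= (K q_n)^(D d^n)] (lemma
    [cf_den_growth]).  By induction [q_(n+1)], and so [alpha_(n+1)], is at most
    [B ^+ growth_exponent d D n.+1] for a fixed [B] (lemma
    [growth_exponent_bound]), and the sequence in the growth hypothesis is
    bounded.

    The polynomial that kills [beta_n] is obtained from linear algebra: tensor
    products of companion matrices give commuting integer matrices with
    the generators as joint eigenvalues (lemma [commuting_companions]), and the
    polynomial is the characteristic polynomial of the same expression in these
    matrices.  Some of its roots may vanish, since the conjugates are chosen
    independently of each other; that is why only nonzero roots enter the
    product. *)

(** * Nonzero roots of monic integer polynomials *)

(** After division by the largest power of ['X] that divides [F], the constant
    term is a nonzero integer, and up to sign it is the product of the nonzero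
    roots of [F]; so the modulus of this product is at least 1.  All factors
    other than [b] are bounded by [M].  The exponent exceeds the number of these
    factors, which is harmless as [1 <= M]. *)
Lemma monic_int_root_norm (C : numClosedFieldType) (F : {poly int}) (b M : C) :
  F \is monic -> root (map_poly intr F) b -> b != 0 -> 1 <= M ->
  (forall z, root (map_poly intr F) z -> `|z| <= M) ->
  1 <= `|b| * M ^+ (size F).-1.
Proof.
move=> monF rootFb b0 M1 leM.
have [rs /=] := closed_field_poly_normal (map_poly intr F : {poly C}).
rewrite (monicP (monic_map _ monF)) scale1r => Frs.
have sz_rs : size rs = (size F).-1.
  have := congr1 (fun p : {poly C} => size p) Frs.
  rewrite size_map_inj_poly ?rmorph0 //; last exact: intr_inj.
  by rewrite size_prod_XsubC => ->.
have rootE z : root (map_poly intr F) z = (z \in rs) by rewrite Frs root_prod_XsubC.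
pose nz := [seq z <- rs | z != 0].
have Fnz : (map_poly intr F : {poly C}) =
    'X^(count (pred1 0) rs) * \prod_(z <- nz) ('X - z%:P).
  rewrite Frs (bigID (pred1 0)) /= [X in _ = _ * X]big_filter; congr (_ * _).
  rewrite (eq_bigr (fun=> 'X)) => [|z /eqP->]; last by rewrite subr0.
  by rewrite big_const_seq iter_mulr_1.
have prod1 : 1 <= \prod_(z <- nz) `|z|.
  have -> : \prod_(z <- nz) `|z| = `|(F`_(count (pred1 0) rs))%:~R : C|.
    rewrite -coef_map Fnz coefXnM ltnn subnn -horner_coef0 horner_prod normr_prod.
    by apply: eq_bigr => z _; rewrite hornerXsubC sub0r normrN.
  rewrite -intr_norm ler1z -gtz0_ge1 normr_gt0 -(intr_eq0 C) -coef_map.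
  rewrite Fnz coefXnM ltnn subnn.
  rewrite -horner_coef0 horner_prod prodf_seq_neq0; apply/allP => z.
  by rewrite mem_filter hornerXsubC sub0r oppr_eq0 => /andP[].
have b_nz : b \in nz by rewrite mem_filter b0 -rootE.
apply: (le_trans prod1); rewrite (perm_big _ (perm_to_rem b_nz)) big_cons /=.
apply: ler_wpM2l => //.
apply: (@le_trans _ _ (M ^+ size (rem b nz))).
  have : {in rem b nz, forall z, `|z| <= M}.
    by move=> z /mem_rem; rewrite mem_filter -rootE => /andP[_ /leM].
  elim: (rem b nz) => [_|z s IHs le_sM]; first by rewrite big_nil.
  rewrite big_cons exprS ler_pM ?normr_ge0 ?prodr_ge0 //.
    by rewrite le_sM ?mem_head.
  by apply: IHs => y sy; rewrite le_sM // inE sy orbT.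
rewrite ler_weXn2l // (leq_trans (size_subseq (rem_subseq _ _))) //.
by rewrite -sz_rs size_filter count_size.
Qed.

(** * Continuants and commuting matrices *)

(** Restricting the matrices to [V] reduces this to the existence of a common
    eigenvector in the whole space. *)
Lemma stable_common_eigenvector (C : numClosedFieldType) n (As : seq 'M[C]_n)
    (V : 'M[C]_n) :
  V != 0 -> {in As &, forall A B, comm_mx A B} ->
  {in As, forall A, stablemx V A} ->
  exists2 v : 'rV_n, v != 0 & (v <= V)%MS /\ {in As, forall A, stablemx v A}.
Proof.
move=> V0 comAs stabV.
have [||v v0 /allP /= stab_v] := @common_eigenvector C _ [seq restrictmx V B | B <- As].
- by rewrite lt0n mxrank_eq0.
- move=> _ _ /= /mapP[B BAs ->] /mapP[B' B'As ->].
  have comBB' : B *m B' = B' *m B by apply: comAs.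
  by rewrite /comm_mx -!conjmxM ?inE ?stablemx_row_base ?comBB'; try exact: stabV.
exists (v *m row_base V); first by rewrite mulmx_free_eq0 ?row_base_free.
split; first by rewrite mulmx_sub // eq_row_base.
move=> B BAs; rewrite -stablemx_restrict; last exact: stabV.
exact/stab_v/map_f.
Qed.

(** The recursion of [cf_num] and [cf_den] over an arbitrary ring: it is
    evaluated at complex numbers, at conjugates and at commuting integer
    matrices. *)
Fixpoint continuant (S : pzRingType) (c0 c1 : S) (a : nat -> S) (n : nat) : S :=
  match n with
  | 0 => c0
  | 1 => c1
  | (m.+1 as k).+1 => a n * continuant c0 c1 a k + continuant c0 c1 a m
  end.

Definition cfnum (S : pzRingType) (a : nat -> S) := continuant 0 1 a.
Definition cfden (S : pzRingType) (a : nat -> S) := continuant 1 (a 1%N) a.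

Lemma nat_ind2 (Q : nat -> Prop) :
  Q 0%N -> Q 1%N -> (forall n, Q n -> Q n.+1 -> Q n.+2) -> forall n, Q n.
Proof.
move=> Q0 Q1 QS n; suff [] : Q n /\ Q n.+1 by [].
by elim: n => [//|n [Qn Qn1]]; split=> //; apply: QS.
Qed.

Lemma continuantSS (S : pzRingType) (c0 c1 : S) (a : nat -> S) n :
  continuant c0 c1 a n.+2 =
  a n.+2 * continuant c0 c1 a n.+1 + continuant c0 c1 a n.
Proof. by []. Qed.

Lemma map_continuant (N : nat) (S T : pzRingType) (f : {rmorphism S -> T})
    (C0 C1 : 'M[S]_N) (A : nat -> 'M[S]_N) n :
  map_mx f (continuant C0 C1 A n)
    = continuant (map_mx f C0) (map_mx f C1) (fun i => map_mx f (A i)) n.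
Proof.
elim/nat_ind2: n => [//|//|n IH0 IH1].
by rewrite !continuantSS -IH0 -IH1 map_mxD map_mxM.
Qed.

Lemma comm_continuant (N : nat) (S : pzRingType) (B C0 C1 : 'M[S]_N)
    (A : nat -> 'M[S]_N) n :
  comm_mx B C0 -> comm_mx B C1 -> (forall i, comm_mx B (A i)) ->
  comm_mx B (continuant C0 C1 A n).
Proof.
move=> BC0 BC1 BA; elim/nat_ind2: n => [//|//|n IH0 IH1].
by rewrite continuantSS; apply: comm_mxD => //; apply: comm_mxM.
Qed.

(** A joint eigenvector of the [A i] turns the continuant of matrices into the
    continuant of the eigenvalues. *)
Lemma eigen_continuant (K : fieldType) N (A : nat -> 'M[K]_N) (g : nat -> K)
    (C0 C1 : 'M[K]_N) (c0 c1 : K) (v : 'rV[K]_N) n :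
  v *m C0 = c0 *: v -> v *m C1 = c1 *: v ->
  (forall i, (1 < i <= n)%N -> v *m A i = g i *: v) ->
  v *m continuant C0 C1 A n = continuant c0 c1 g n *: v.
Proof.
move=> vC0 vC1; elim/nat_ind2: n => [//|//|n IH0 IH1] vA.
rewrite !continuantSS mulmxDr mulmxA vA ?leqnn // -scalemxAl IH0 ?IH1; last first.
- by move=> i /andP[i1 ilen]; rewrite vA // i1 ltnW // ltnW.
- by move=> i /andP[i1 ilen]; rewrite vA // i1 ltnW.
by rewrite scalerDl scalerA.
Qed.

(** Continuants have nonnegative coefficients, so the triangle inequality lets
    every argument be replaced by an upper bound of its modulus. *)
Lemma norm_continuant (K : numDomainType) (g x : nat -> K) (c0 c1 d0 d1 : K) n :
  `|c0| <= d0 -> `|c1| <= d1 -> (forall i, (1 < i <= n)%N -> `|g i| <= x i) ->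
  `|continuant c0 c1 g n| <= continuant d0 d1 x n.
Proof.
move=> le0 le1; elim/nat_ind2: n => [//|//|n IH0 IH1] gx.
rewrite !continuantSS.
apply: (le_trans (ler_normD _ _)); rewrite normrM lerD //.
  rewrite ler_pM ?normr_ge0 // ?gx ?leqnn //.
  by apply: IH1 => i /andP[i1 ilen]; rewrite gx // i1 ltnW.
by apply: IH0 => i /andP[i1 ilen]; rewrite gx // i1 ltnW // ltnW.
Qed.

Lemma stable_rowE (K : fieldType) N (v : 'rV[K]_N) (A : 'M[K]_N) j :
  stablemx v A -> v 0 j != 0 -> v *m A = ((v *m A) 0 j / v 0 j) *: v.
Proof.
move=> /eigenvectorP[a /eigenspaceP ->] vj0.
by rewrite mxE mulfK.
Qed.

Lemma map_lin_mulmxr (S T : comNzRingType) (f : {rmorphism S -> T}) m n p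
    (B : 'M[S]_(n, p)) :
  map_mx f (lin_mulmxr B : 'M[S]_(m * n, m * p)) = lin_mulmxr (map_mx f B).
Proof. by apply: map_lin_mx => A; apply: map_mxM. Qed.

Lemma map_lin_mulmx (S T : comNzRingType) (f : {rmorphism S -> T}) m n p
    (B : 'M[S]_(m, n)) :
  map_mx f (lin_mulmx B : 'M[S]_(n * p, m * p)) = lin_mulmx (map_mx f B).
Proof. by apply: map_lin_mx => A; apply: map_mxM. Qed.

Lemma lin_mulmxrM (S : comNzRingType) m n (A B : 'M[S]_n) :
  lin_mulmxr A *m lin_mulmxr B = lin_mulmxr (A *m B) :> 'M[S]_(m * n).
Proof.
by apply/row_matrixP=> i; rewrite !rowE mulmxA !mul_rV_lin /= mxvecK mulmxA.
Qed.

(** On the space of [m] by [n] matrices, left multiplications commute with right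
    multiplications by associativity.  These operators play the role of
    [B (x) 1] and [1 (x) A] on a tensor product. *)
Lemma lin_mulmxrC (S : comNzRingType) m n (A : 'M[S]_n) (B : 'M[S]_m) :
  lin_mulmxr A *m lin_mulmx B = lin_mulmx B *m lin_mulmxr A :> 'M[S]_(m * n).
Proof.
by apply/row_matrixP=> i; rewrite !rowE !mulmxA !mul_rV_lin /= !mxvecK mulmxA.
Qed.

Lemma eigenvalue_lin_mulmxr (K : fieldType) m n (A : 'M[K]_n) a :
  eigenvalue (lin_mulmxr A : 'M[K]_(m * n)) a -> eigenvalue A a.
Proof.
case/eigenvalueP=> u uA u0; have [i rowi0] : exists i, row i (vec_mx u) != 0.
  apply/existsP; apply: contraR u0; rewrite negb_exists => /forallP z.
  apply/eqP/(can_inj vec_mxK); rewrite linear0; apply/row_matrixP => i.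
  by rewrite row0; exact/eqP/negbNE/z.
apply/eigenvalueP; exists (row i (vec_mx u)) => //; rewrite -row_mul.
have <- : vec_mx (u *m lin_mulmxr A) = vec_mx u *m A by rewrite mx_rV_lin.
by rewrite uA !linearZ.
Qed.

Lemma eigenvalue_tr (K : fieldType) n (A : 'M[K]_n) a :
  eigenvalue A^T a = eigenvalue A a.
Proof.
rewrite !eigenvalue_root_char /char_poly -(det_tr (char_poly_mx A)).
congr (root (\det _) a); apply/matrixP => i j.
by rewrite !mxE eq_sym.
Qed.

Lemma eigenvalue_lin_mulmx (K : fieldType) m n (A : 'M[K]_m) a :
  eigenvalue (lin_mulmx A : 'M[K]_(m * n)) a -> eigenvalue A a.
Proof.
case/eigenvalueP=> u uA u0; have [i coli0] : exists i, row i (vec_mx u)^T != 0.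
  apply/existsP; apply: contraR u0; rewrite negb_exists => /forallP z.
  apply/eqP/(can_inj vec_mxK)/trmx_inj; rewrite !linear0; apply/row_matrixP => i.
  by rewrite row0; exact/eqP/negbNE/z.
rewrite -eigenvalue_tr; apply/eigenvalueP; exists (row i (vec_mx u)^T) => //.
rewrite -row_mul -trmx_mul.
have <- : vec_mx (u *m lin_mulmx A) = A *m vec_mx u by rewrite mx_rV_lin.
by rewrite uA !linearZ.
Qed.

(** The integer matrices model multiplication by the [Y i] on the tensor product
    of the rings [Z[Y]/(P i)].  Adding one polynomial replaces the space of rows
    by a space of matrices, on which the old operators act from the right and
    the companion matrix of the new polynomial acts from the left; neither
    action creates new eigenvalues, and an outer product of eigenvectors is a
    joint eigenvector.  All the matrices beyond index [n] are kept commuting with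
    the others, so that commutation needs no bound on the indices. *)
Lemma commuting_companions (C : numClosedFieldType) (n : nat)
    (P : nat -> {poly int}) (x : nat -> C) :
  (forall i, (i < n)%N -> P i \is monic) ->
  (forall i, (i < n)%N -> root (map_poly intr (P i)) (x i)) ->
  exists (N : nat) (A : nat -> 'M[int]_N) (v : 'rV[C]_N),
  [/\ N = (\prod_(i < n) (size (P i)).-1)%N,
      v != 0 /\ (forall i, (i < n)%N -> v *m map_mx intr (A i) = x i *: v),
      forall i j, comm_mx (A i) (A j) &
      forall i (a : C), (i < n)%N -> eigenvalue (map_mx intr (A i)) a ->
        root (map_poly intr (P i)) a].
Proof.
elim: n => [|n IHn] monP rootP.
  exists 1%N, (fun=> 0), (const_mx 1); split=> //; first by rewrite big_ord0.
  by split=> //; apply/eqP => /rowP/(_ 0); rewrite !mxE => /eqP; rewrite oner_eq0.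
have [i /ltnW|i /ltnW|N [A [v [defN [v0 vA] commA specA]]]] := IHn; first exact: monP.
  exact: rootP.
pose m := (size (P n)).-1; pose B := companionmx (P n) : 'M[int]_m.
have charB (a : C) :
    eigenvalue (map_mx intr B) a = root (map_poly intr (P n) : {poly C}) a.
  by rewrite eigenvalue_root_char -map_char_poly companionmxK ?monP.
have /eigenvalueP[u uB u0] : eigenvalue (map_mx intr B)^T (x n).
  by rewrite eigenvalue_tr charB rootP.
exists (m * N)%N.
exists (fun i => if i == n then lin_mulmx B else lin_mulmxr (A i)).
(* A left eigenvector of [B^T] gives the column [u^T], a right one of [B]. *)
exists (mxvec (u^T *m v)); split.
- by rewrite big_ord_recr /= -defN mulnC.
- split.
    rewrite mxvec_eq0; apply: contra u0 => /eqP uv0.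
    have [j vj0] : exists j, v 0 j != 0 by apply/rV0Pn.
    apply/eqP/rowP => i; have /matrixP/(_ i j) := uv0.
    rewrite !mxE big_ord1 !mxE => /eqP; rewrite mulf_eq0 (negPf vj0) orbF.
    by move/eqP.
  move=> i; rewrite ltnS leq_eqVlt; case: eqP => [-> _|_ /= ltin].
    rewrite map_lin_mulmx mul_vec_lin /= mulmxA -linearZ /=.
    rewrite -[map_mx _ _]trmxK -trmx_mul uB.
    by rewrite linearZ /= scalemxAl.
  by rewrite map_lin_mulmxr mul_vec_lin /= -mulmxA vA // -linearZ /= scalemxAr.
- move=> i j; rewrite /comm_mx.
  case: ifP => _; case: ifP => _ //; rewrite ?lin_mulmxrC // !lin_mulmxrM.
  by congr lin_mulmxr; apply: commA.
move=> i a; rewrite ltnS leq_eqVlt; case: eqP => [-> _|_ /= ltin].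
  by rewrite map_lin_mulmx => /eigenvalue_lin_mulmx; rewrite charB.
by rewrite map_lin_mulmxr => /eigenvalue_lin_mulmxr; apply: specA.
Qed.

(** * A Liouville inequality for continued fractions *)

(** [beta] is the eigenvalue, at the joint eigenvector, of the integer matrix [B]
    that evaluates the same expression at the commuting matrices.  Any other
    eigenvalue of [B] has an eigenspace stable under these matrices; a joint
    eigenvector inside it shows that the eigenvalue is the same expression in
    roots of the [P i], hence is bounded by [M].  Thus [monic_int_root_norm]
    applies to the characteristic polynomial of [B].  A continued fraction has
    no use for the index 0, so [x 0] carries the number to be approximated,
    multiplied by [c]. *)
Lemma continued_fraction_liouville (C : numClosedFieldType) (n : nat)
    (P : nat -> {poly int}) (x : nat -> C) (h : C) (c : int) :
  let beta := cfden x n * x 0%N - c%:~R * cfnum x n in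
  let M := cfden x n * h + `|c|%:~R * cfnum x n in
  (0 < n)%N ->
  (forall i, (i <= n)%N -> P i \is monic) ->
  (forall i, (i <= n)%N -> root (map_poly intr (P i)) (x i)) ->
  (forall z : C, root (map_poly intr (P 0%N)) z -> `|z| <= h) ->
  (forall i (z : C), (0 < i <= n)%N -> root (map_poly intr (P i)) z -> `|z| <= x i) ->
  beta != 0 -> 1 <= M ->
  1 <= `|beta| * M ^+ (\prod_(i < n.+1) (size (P i)).-1).
Proof.
move=> beta M n0 monP rootP leh lex beta0 M1.
have [//|//|N [A [v [<- [v0 vA] commA specA]]]] := @commuting_companions C n.+1 P x.
pose A' i : 'M[C]_N := map_mx intr (A i).
pose B : 'M[int]_N := cfden A n *m A 0%N - c *: cfnum A n.
pose B' : 'M[C]_N := map_mx intr B.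
have commA' i j : comm_mx (A' i) (A' j) by rewrite /comm_mx -!map_mxM commA.
have B'E : B' = cfden A' n *m A' 0%N - c%:~R *: cfnum A' n.
  rewrite /B' map_mxB map_mxM map_mxZ /cfden /cfnum !map_continuant.
  by rewrite map_mx0 !map_mx1.
have commB i : comm_mx B' (A' i).
  rewrite B'E; apply/comm_mx_sym/comm_mxB.
    apply: comm_mxM => //; apply: comm_continuant => //; exact: comm_mx1.
  rewrite -mul_scalar_mx; apply: comm_mxM; first exact: comm_mx_scalar.
  apply: comm_continuant => //; first exact: comm_mx0.
  exact: comm_mx1.
have vB (w : 'rV_N) g : (forall i, (i <= n)%N -> w *m A' i = g i *: w) ->
    w *m B' = (cfden g n * g 0%N - c%:~R * cfnum g n) *: w.
  move=> wA; rewrite B'E mulmxBr mulmxA -scalemxAr.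
  rewrite (@eigen_continuant _ _ _ g _ _ 1 (g 1%N)) ?wA //; last 2 first.
  - by rewrite mulmx1 scale1r.
  - by move=> i /andP[_ ?]; rewrite wA.
  rewrite -scalemxAl wA // (@eigen_continuant _ _ _ g _ _ 0 1); first last.
  - by move=> i /andP[_ ?]; rewrite wA.
  - by rewrite mulmx1 scale1r.
  - by rewrite mulmx0 scale0r.
  by rewrite !scalerA -scalerBl.
pose F := char_poly B.
have rootF (z : C) : root (map_poly intr F) z = eigenvalue B' z.
  by rewrite map_char_poly -eigenvalue_root_char.
have -> : N = (size F).-1 by rewrite size_char_poly.
apply: monic_int_root_norm => //; first exact: char_poly_monic.
  by rewrite rootF; apply/eigenvalueP; exists v => //; apply: vB => i lein; apply: vA.
move=> z; rewrite rootF => eigz.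
have [|||w w0 [wz stabw]] := @stable_common_eigenvector C N
    [seq A' i | i <- iota 0 n.+1] (eigenspace B' z).
- by [].
- by move=> _ _ /mapP[i _ ->] /mapP[j _ ->].
- by move=> _ /mapP[i _ ->]; apply: comm_mx_stable_eigenspace.
have [j wj0] := rV0Pn w w0.
have [g wA] : exists g : nat -> C, forall i, (i <= n)%N -> w *m A' i = g i *: w.
  exists (fun i => (w *m A' i) 0 j / w 0 j) => i lein; apply: stable_rowE => //.
  by apply/stabw/map_f; rewrite mem_iota.
have rootg i : (i <= n)%N -> root (map_poly intr (P i)) (g i).
  by move=> lein; apply: specA => //; apply/eigenvalueP; exists w => //; apply: wA.
have -> : z = cfden g n * g 0%N - c%:~R * cfnum g n.
  apply: (mulIf wj0); have /rowP/(_ j) := vB w g wA.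
  by rewrite (eigenspaceP wz) !mxE.
have gx i : (1 < i <= n)%N -> `|g i| <= x i.
  by move=> /andP[i1 lein]; apply: lex (rootg _ lein); rewrite lein ltnW.
apply: (le_trans (ler_normB _ _)); rewrite !normrM -intr_norm lerD //.
  apply: ler_pM; rewrite ?normr_ge0 //; last exact/leh/rootg.
  apply: norm_continuant; rewrite ?normr1 //.
  by apply: lex; rewrite ?rootg // n0.
by rewrite ler_wpM2l ?ler0z // norm_continuant ?normr1 ?normr0.
Qed.

(** * Minimal polynomials, conjugates and the house *)

Lemma map_poly_ratr_int (K : numFieldType) (p : {poly int}) :
  map_poly ratr (map_poly intr p) = map_poly intr p :> {poly K}.
Proof. by rewrite -map_poly_comp; apply: eq_map_poly => k /=; rewrite ratr_int. Qed.

Lemma root_ratr_real_complex (R : realType) (p : {poly rat}) (x : R) :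
  root (map_poly ratr p) (real_complex R x) = root (map_poly ratr p) x.
Proof.
rewrite -(fmorph_root (real_complex R)) -map_poly_comp; congr (root _ _).
by apply: eq_map_poly => q /=; rewrite fmorph_rat.
Qed.

(** A nonzero annihilating polynomial of least size is irreducible: if it
    splits, one factor vanishes at [x] and has full size by minimality. *)
Lemma is_min_poly_exists (K : numFieldType) (x : K) :
  algebraicOver (ratr : rat -> K) x -> exists p, is_min_poly x p.
Proof.
case=> p p0 rootp.
pose Q k := `[< exists2 q : {poly rat},
  q != 0 & root (map_poly ratr q) x /\ size q = k >].
have exQ : exists k, Q k by exists (size p); apply/asboolP; exists p.
case: (ex_minnP exQ) => _ /asboolP[q q0 [rootq <-]] minq.
have leq_size r : r != 0 -> root (map_poly ratr r) x -> (size q <= size r)%N.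
  by move=> r0 rootr; apply: minq; apply/asboolP; exists r.
exists ((lead_coef q)^-1 *: q); split.
- by rewrite monicE lead_coefZ mulVf // lead_coef_eq0.
- have lq0 : (lead_coef q)^-1 != 0 by rewrite invr_eq0 lead_coef_eq0.
  split.
    rewrite size_scale // -(size_map_poly (ratr : {rmorphism rat -> K})).
    by apply: root_size_gt1 rootq; rewrite map_poly_eq0.
  move=> r sr; rewrite dvdpZr // => rq; rewrite (eqp_rtrans (eqp_scale _ _)) //.
  have [s qE] := dvdpP _ _ rq.
  have /norP[s0 r0] : ~~ ((s == 0) || (r == 0)) by rewrite -mulf_eq0 -qE.
  rewrite -dvdp_size_eqp // eqn_leq dvdp_leq //=.
  move: (rootq); rewrite {1}qE rmorphM rootM => /orP[rs|]; last exact: leq_size.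
  have := leq_size _ s0 rs; rewrite {1}qE size_mul //.
  move: sr (size_poly_eq0 r) => /=; rewrite (negPf r0).
  case: (size r) => [|[|k]] //= _ _; rewrite !addnS /=.
  by rewrite -ltn_subRL subnn.
- by rewrite map_polyZ /= rootZ // fmorph_eq0 invr_eq0 lead_coef_eq0.
Qed.

Lemma min_polyP (K : numFieldType) (x : K) :
  algebraicOver (ratr : rat -> K) x -> is_min_poly x (min_poly x).
Proof. by move=> /is_min_poly_exists /xgetPex; apply. Qed.

Lemma min_poly_dvd (K : numFieldType) (x : K) p :
  algebraicOver (ratr : rat -> K) x -> root (map_poly ratr p) x -> min_poly x %| p.
Proof.
move=> /min_polyP[_ [_ irr] rootm] rootp.
have rootg : root (map_poly ratr (gcdp (min_poly x) p)) x.
  by rewrite gcdp_map root_gcd rootm.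
rewrite -(eqp_dvdl _ (irr (gcdp (min_poly x) p) _ (dvdp_gcdl _ _))) ?dvdp_gcdr //.
apply/negP => /size_poly1P[c c0 gE]; move: rootg.
by rewrite gE map_polyC rootC fmorph_eq0 (negPf c0).
Qed.

Lemma min_poly_real_complex (R : realType) (x : R) :
  min_poly (real_complex R x) = min_poly x.
Proof.
congr (xget _ _); apply/seteqP.
by split=> p [] ? ? rt; split=> //; move: rt; rewrite root_ratr_real_complex.
Qed.

Lemma integral_algebraic_rat (K : numFieldType) (x : K) :
  integralOver (intr : int -> K) x -> algebraicOver (ratr : rat -> K) x.
Proof.
case=> p monp rootp; exists (map_poly intr p); last by rewrite map_poly_ratr_int.
by rewrite map_poly_eq0_id0 ?intr_eq0 ?lead_coef_eq0 monic_neq0.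
Qed.

(** Gauss's lemma makes the minimal polynomial proportional to an integer factor
    of a monic integer polynomial; the leading coefficient of such a factor is
    a unit. *)
Lemma min_poly_int (K : numFieldType) (x : K) :
  integralOver (intr : int -> K) x ->
  exists2 F : {poly int}, F \is monic & min_poly x = map_poly intr F.
Proof.
move=> intx; have algx := integral_algebraic_rat intx.
have [monm _ _] := min_polyP algx.
case: intx => p monp rootp.
have : min_poly x %| map_poly intr p.
  by apply: min_poly_dvd => //; rewrite map_poly_ratr_int.
case/dvdpP_rat_int => F [a a0 mE] [r pE].
have := congr1 lead_coef pE; rewrite (monicP monp) lead_coefM => /esym lFr.
have lu : lead_coef F \is a GRing.unit by apply/unitrPr; exists (lead_coef r).
have lF2 : lead_coef F * lead_coef F = 1.
  by case/orP: lu => /eqP ->.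
exists (lead_coef F *: F); first by rewrite monicE lead_coefZ lF2.
have := congr1 lead_coef mE; rewrite (monicP monm) lead_coefZ.
rewrite lead_coef_map_inj //; last exact: intr_inj.
rewrite map_polyZ /= mE => a1; congr (_ *: _).
by rewrite -[a]mulr1 -[1 in LHS](rmorph1 intr) -lF2 rmorphM mulrA -a1 mul1r.
Qed.

Lemma norm_complexE (R : realType) (z : R[i]) :
  `|z| = real_complex R (ComplexField.Normc.normc z).
Proof. by case: z => a b; rewrite normc_def. Qed.

Lemma conjugates_rootE (R : realType) (x z : R[i]) :
  algebraicOver (ratr : rat -> R[i]) x ->
  (z \in conjugates x) = root (map_poly ratr (min_poly x)) z.
Proof.
move=> /min_polyP[monm _ _]; rewrite /conjugates.
case: closed_field_poly_normal => rs /= E.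
by rewrite [in RHS]E (monicP (monic_map _ monm)) scale1r root_prod_XsubC.
Qed.

Lemma conjugate_le_house (R : realType) (x z : R[i]) :
  z \in conjugates x -> ComplexField.Normc.normc z <= house x.
Proof. by move=> zx; rewrite /house; exact: le_bigmax_seq. Qed.

(** The hypothesis on the house enters the main argument only in this form:
    [x] itself bounds the roots of its minimal integer polynomial. *)
Lemma integral_house_poly (R : realType) (x : R) :
  0 < x -> integralOver (intr : int -> R) x -> `|x| = house (real_complex R x) ->
  exists F : {poly int}, [/\ F \is monic, (size F).-1 = alg_degree x,
    root (map_poly intr F) (real_complex R x) &
    forall z : R[i], root (map_poly intr F) z -> `|z| <= real_complex R x].
Proof.
move=> x0 intx hx; have algx := integral_algebraic_rat intx.
have algxC : algebraicOver (ratr : rat -> R[i]) (real_complex R x).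
  by case: algx => p p0 rootp; exists p => //; rewrite root_ratr_real_complex.
have [F monF mE] := min_poly_int intx.
have FE : map_poly intr F = map_poly ratr (min_poly (real_complex R x)) :> {poly R[i]}.
  by rewrite min_poly_real_complex mE map_poly_ratr_int.
exists F; split=> //.
  by rewrite /alg_degree mE size_map_inj_poly //; apply: intr_inj.
  by rewrite FE root_ratr_real_complex min_poly_real_complex; have [] := min_polyP algx.
move=> z; rewrite FE -conjugates_rootE // => zx.
by rewrite norm_complexE lecR -(gtr0_norm x0) hx conjugate_le_house.
Qed.

(** With [m] the degree of [p] and [c] its leading coefficient,
    [c ^+ m.-1 * p.[a]] is a monic integer polynomial in [c * a]. *)
Lemma lead_coef_mul_root (K : comNzRingType) (p : {poly int}) (a : K) :
  (1 < size p)%N -> root (map_poly intr p) a ->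
  exists F : {poly int}, [/\ F \is monic, size F = size p &
    root (map_poly intr F) ((lead_coef p)%:~R * a)].
Proof.
move=> p1 rootp; set c := lead_coef p; set m := (size p).-1.
have sp : size p = m.+1 by rewrite prednK // ltnW.
have mS : m = m.-1.+1 by rewrite prednK // -ltnS -sp.
pose E i := if i == m then 1 else p`_i * c ^+ (m.-1 - i).
have sF : size (\poly_(i < m.+1) E i) = m.+1.
  by rewrite size_poly_eq // /E eqxx oner_eq0.
exists (\poly_(i < m.+1) E i); split; rewrite ?sF //.
  by rewrite monicE lead_coefE sF coef_poly ltnSn /E eqxx.
have sz : (size (map_poly (intr : int -> K) (\poly_(i < m.+1) E i)) <= m.+1)%N.
  by rewrite (leq_trans (size_poly _ _)) // sF.
have szp : (size (map_poly (intr : int -> K) p) <= m.+1)%N.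
  by rewrite (leq_trans (size_poly _ _)) // sp.
rewrite /root (horner_coef_wide _ sz); move: rootp.
rewrite /root (horner_coef_wide _ szp) => /eqP rootp; apply/eqP.
transitivity (c%:~R ^+ m.-1 * \sum_(i < m.+1) (map_poly intr p)`_i * a ^+ i);
  last first.
  by rewrite rootp mulr0.
rewrite mulr_sumr; apply: eq_bigr => i _.
rewrite !coef_map /= coef_poly ltn_ord /E exprMn; case: eqP => [->|/eqP im].
  have -> : p`_m = c by rewrite /c lead_coefE.
  by rewrite mulr1z mul1r mulrA -exprSr -mS.
have lei : (i <= m.-1)%N by rewrite -ltnS -mS ltn_neqAle im -ltnS ltn_ord.
rewrite -[in RHS](subnK lei) exprD intrM rmorphXn /=.
by rewrite [X in X * _]mulrC mulrACA.
Qed.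

(** The bound [h] is taken at least 1 so that the bound on the conjugates in the
    Liouville inequality is at least 1 too. *)
Lemma algebraic_scaled_integral_poly (R : realType) (x : R) :
  algebraicOver (ratr : rat -> R) x ->
  exists (c : int) (F : {poly int}) (h : R), [/\ c != 0, F \is monic,
    (size F).-1 = alg_degree x,
    root (map_poly intr F) (c%:~R * real_complex R x) &
    1 <= h /\ forall z : R[i], root (map_poly intr F) z -> `|z| <= real_complex R h].
Proof.
move=> algx; have [monm irrm rootm] := min_polyP algx.
have [p [a a0 mE]] := rat_poly_scale (min_poly x).
have a0' : (a%:~R : rat)^-1 != 0 by rewrite invr_eq0 intr_eq0.
have szE : size p = size (min_poly x).
  by rewrite mE size_scale // size_map_inj_poly //; apply: intr_inj.
have rootp : root (map_poly intr p) (real_complex R x).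
  have -> : map_poly intr p = map_poly (real_complex R) (map_poly intr p) :> {poly R[i]}.
    by rewrite -map_poly_comp; apply: eq_map_poly => k /=; rewrite rmorph_int.
  rewrite fmorph_root; move: rootm; rewrite mE map_polyZ /= rootZ ?fmorph_eq0 //.
  by rewrite map_poly_ratr_int.
have p1 : (1 < size p)%N by rewrite szE; case: irrm.
have [F [monF sF rootF]] := lead_coef_mul_root p1 rootp.
have [rs /=] := closed_field_poly_normal (map_poly intr F : {poly R[i]}).
rewrite (monicP (monic_map _ monF)) scale1r => Frs.
pose h := \big[Num.max/1]_(z <- rs) ComplexField.Normc.normc z.
exists (lead_coef p), F, h; split=> //.
- by rewrite lead_coef_eq0 -size_poly_gt0 ltnW.
- by rewrite sF szE.
split; first by rewrite /h bigmax_ge_id.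
move=> z; rewrite Frs root_prod_XsubC => zrs.
by rewrite norm_complexE lecR; exact: le_bigmax_seq.
Qed.

(** * Convergents of a continued fraction with partial quotients at least 1 *)

Lemma cf_numE (R : realType) (a : nat -> R) n : cf_num a n = cfnum a n.
Proof.
rewrite /cfnum; elim/nat_ind2: n => [//|//|n IH0 IH1].
by rewrite continuantSS -IH0 -IH1.
Qed.

Lemma cf_denE (R : realType) (a : nat -> R) n : cf_den a n = cfden a n.
Proof.
rewrite /cfden; elim/nat_ind2: n => [//|//|n IH0 IH1].
by rewrite continuantSS -IH0 -IH1.
Qed.

Lemma cf_denSS (R : realType) (a : nat -> R) n :
  cf_den a n.+2 = a n.+2 * cf_den a n.+1 + cf_den a n.
Proof. by []. Qed.

Lemma cf_numSS (R : realType) (a : nat -> R) n :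
  cf_num a n.+2 = a n.+2 * cf_num a n.+1 + cf_num a n.
Proof. by []. Qed.

Lemma cf_den_ge1 (R : realType) (a : nat -> R) n :
  (forall n, (1 <= n)%N -> 1 <= a n) ->
  1 <= cf_den a n.
Proof.
move=> a_ge1; elim/nat_ind2: n => [//| |n IH0 IH1]; first exact: a_ge1.
have an := a_ge1 _ (ltn0Sn n.+1).
by rewrite cf_denSS; nra.
Qed.

Lemma cf_den_gt0 (R : realType) (a : nat -> R) n :
  (forall n, (1 <= n)%N -> 1 <= a n) ->
  0 < cf_den a n.
Proof. by move=> a_ge1; apply: lt_le_trans ltr01 (cf_den_ge1 n a_ge1). Qed.

Lemma cf_den_add_le (R : realType) (a : nat -> R) n :
  (forall n, (1 <= n)%N -> 1 <= a n) ->
  cf_den a n.+1 + cf_den a n <= cf_den a n.+2.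
Proof.
move=> a_ge1; have an := a_ge1 _ (ltn0Sn n.+1).
by rewrite cf_denSS lerD2r ler_peMl // ltW // cf_den_gt0.
Qed.

Lemma cf_den_ge_nat (R : realType) (a : nat -> R) n :
  (forall n, (1 <= n)%N -> 1 <= a n) ->
  n%:R <= cf_den a n.
Proof.
move=> a_ge1; elim: n => [|[|n] IH]; first exact: le_trans ler01 (cf_den_ge1 0 a_ge1).
  exact: a_ge1.
rewrite -natr1; apply: le_trans (cf_den_add_le n a_ge1).
by rewrite lerD // cf_den_ge1.
Qed.

Lemma cf_num_ge0_le_den (R : realType) (a : nat -> R) n :
  (forall n, (1 <= n)%N -> 1 <= a n) ->
  0 <= cf_num a n <= cf_den a n.
Proof.
move=> a_ge1; elim/nat_ind2: n => [| |n /andP[IH0 IH0'] /andP[IH1 IH1']].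
- by rewrite lexx ler01.
- by rewrite ler01 a_ge1.
have an : 0 <= a n.+2 by rewrite (le_trans ler01) ?a_ge1.
rewrite cf_denSS cf_numSS addr_ge0 ?mulr_ge0 //=.
by rewrite lerD // ler_wpM2l.
Qed.

Lemma cf_det (R : realType) (a : nat -> R) n :
  cf_num a n.+1 * cf_den a n - cf_num a n * cf_den a n.+1 = (-1) ^+ n.
Proof.
elim: n => [|n IH]; first by rewrite /= mulr1 mul0r subr0.
rewrite cf_denSS cf_numSS exprS -IH; ring.
Qed.

Lemma convergents_sub (R : realType) (a : nat -> R) n :
  (forall n, (1 <= n)%N -> 1 <= a n) ->
  cf_num a n.+1 / cf_den a n.+1 - cf_num a n / cf_den a n =
  (-1) ^+ n * (cf_den a n * cf_den a n.+1)^-1.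
Proof.
move=> a_ge1; rewrite -(cf_det a); field.
by rewrite !gt_eqF ?cf_den_gt0.
Qed.

(** The Leibniz criterion: from the index [n] on, all later terms lie on one
    side of [r n], at a distance between [e n - e n.+1] and [e n].  The lower
    bound survives in the limit and keeps [limn r] away from [r n]. *)
Lemma alternating_cvg (R : realType) (r e : nat -> R) :
  (forall n, r n.+1 - r n = (-1) ^+ n * e n) ->
  (forall n, 0 < e n.+1 < e n) -> e @ \oo --> 0 ->
  cvg (r @ \oo) /\ forall n, 0 < (-1) ^+ n * (limn r - r n) <= e n.
Proof.
move=> rS e_dec e_cvg0.
have sgn2 n : (-1) ^+ n * (-1) ^+ n = 1 :> R by rewrite -expr2 sqrr_sign.
have between k n : e n - e n.+1 <= (-1) ^+ n * (r (n + k.+1)%N - r n) <= e n.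
  elim: k n => [|k IHk] n.
    rewrite addn1 rS mulrA sgn2 mul1r lexx andbT.
    by have /andP[e0 _] := e_dec n; rewrite gerBl ltW.
  have -> : (-1) ^+ n * (r (n + k.+2)%N - r n) =
            e n - (-1) ^+ n.+1 * (r (n.+1 + k.+1)%N - r n.+1).
    have -> : e n = (-1) ^+ n * (r n.+1 - r n) by rewrite rS mulrA sgn2 mul1r.
    by rewrite addSnnS exprS; ring.
  have /andP[lo hi] := IHk n.+1; have /andP[_ lt1] := e_dec n.+1.
  by apply/andP; split; lra.
have dist_le n m : (n <= m)%N -> `|r n - r m| <= e n.
  move=> lenm; have e0 : 0 <= e n.
    by have /andP[/ltW h1 /ltW] := e_dec n; apply: le_trans.
  move: lenm; rewrite leq_eqVlt => /orP[/eqP<-|ltnm]; first by rewrite subrr normr0.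
  have /andP[lo hi] := between (m - n.+1)%N n.
  rewrite addnS -addSn subnKC // in lo hi.
  have /andP[_ lt1] := e_dec n.
  rewrite distrC -[`|_|]mul1r -(normr_sign R n) -normrM.
  by rewrite ger0_norm // (le_trans _ lo) // subr_ge0 ltW.
have r_cvg : cvg (r @ \oo).
  apply: cauchy_cvg; apply: cauchy_exP => eps eps0.
  have /cvgrPdist_lt/(_ eps eps0) [N _ HN] := e_cvg0.
  exists (r N); exists N => // m leNm; rewrite /ball /=.
  apply: le_lt_trans (dist_le _ _ leNm) _.
  by have := HN N (leqnn N); rewrite sub0r normrN; apply: le_lt_trans; apply: ler_norm.
split=> // n.
have u_cvg : (fun m => (-1) ^+ n * (r m - r n)) @ \oo --> (-1) ^+ n * (limn r - r n).
  by apply: cvgMr; apply: cvgB => //; apply: cvg_cst.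
have /andP[_ ltn1] := e_dec n.
have near_between : \forall m \near \oo, e n - e n.+1 <= (-1) ^+ n * (r m - r n) <= e n.
  exists n.+1 => // m /= ltnm; have := between (m - n.+1)%N n.
  by rewrite addnS -addSn subnKC.
rewrite -(cvg_lim _ u_cvg) //; apply/andP; split.
  apply: (@lt_le_trans _ _ (e n - e n.+1)); first by rewrite subr_gt0.
  apply: limr_ge; first exact: cvgP u_cvg.
  by apply: filterS near_between => m /andP[].
apply: limr_le; first exact: cvgP u_cvg.
by apply: filterS near_between => m /andP[].
Qed.

(** The convergents form an alternating sequence whose steps are the
    [1 / (q_n q_(n+1))]; multiply the distance to the limit by [q_n]. *)
Lemma cont_frac_approx (R : realType) (a : nat -> R) :
  (forall n, (1 <= n)%N -> 1 <= a n) ->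
  forall n, 0 < `|cf_den a n * cont_frac a - cf_num a n| <= (cf_den a n.+1)^-1.
Proof.
move=> a_ge1 n; pose e n := (cf_den a n * cf_den a n.+1)^-1.
have q0 m := cf_den_gt0 m a_ge1.
have e_dec m : 0 < e m.+1 < e m.
  rewrite /e invr_gt0 mulr_gt0 // andTb ltf_pV2 ?posrE ?mulr_gt0 // mulrC ltr_pM2l //.
  by apply: lt_le_trans (cf_den_add_le m a_ge1); rewrite ltrDr.
have e_cvg : e @ \oo --> 0.
  have h_cvg := @cvg_harmonic R.
  apply: (squeeze_cvgr _ (cvg_cst 0) h_cvg); near=> m.
  have qq0 : 0 < cf_den a m * cf_den a m.+1 by rewrite mulr_gt0.
  apply/andP; split; first by rewrite invr_ge0 ltW.
  rewrite lef_pV2 ?posrE //.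
  apply: le_trans (cf_den_ge_nat m.+1 a_ge1) _.
  by rewrite ler_peMl ?cf_den_ge1 // ltW.
have [_ /(_ n)] := alternating_cvg (fun m => convergents_sub m a_ge1) e_dec e_cvg.
rewrite -/(cont_frac a) => /andP[lo hi].
have -> : cf_den a n * cont_frac a - cf_num a n =
    cf_den a n * (cont_frac a - cf_num a n / cf_den a n).
  by rewrite mulrBr mulrCA divff ?mulr1 // gt_eqF.
have -> : `|cf_den a n * (cont_frac a - cf_num a n / cf_den a n)| =
    cf_den a n * ((-1) ^+ n * (cont_frac a - cf_num a n / cf_den a n)).
  rewrite normrM gtr0_norm //; congr (_ * _).
  by rewrite -[RHS]gtr0_norm // normrM normr_sign mul1r.
rewrite mulr_gt0 // andTb; apply: le_trans (_ : cf_den a n * e n <= _).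
  by rewrite ler_pM2l.
by rewrite /e invfM mulrA divff ?mul1r // gt_eqF.
Unshelve. all: by end_near.
Qed.

(** * Growth of the denominators when the limit is algebraic *)

Lemma rmorph_continuant (S T : pzRingType) (f : {rmorphism S -> T})
    (c0 c1 : S) (a : nat -> S) (x : nat -> T) n :
  (forall i, (1 < i)%N -> x i = f (a i)) ->
  continuant (f c0) (f c1) x n = f (continuant c0 c1 a n).
Proof.
move=> xE; elim/nat_ind2: n => [//|//|n IH0 IH1].
by rewrite !continuantSS xE // IH0 IH1 rmorphD rmorphM.
Qed.

Lemma normr_real_complex (R : realType) (y : R) :
  `|real_complex R y| = real_complex R `|y|.
Proof. by rewrite normc_def /= expr0n addr0 sqrtr_sqr. Qed.

(** If [x < 1] then all conjugates have modulus less than 1, although the modulus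
    of their product is a positive integer. *)
Lemma integral_house_ge1 (R : realType) (x : R) :
  0 < x -> integralOver (intr : int -> R) x -> `|x| = house (real_complex R x) ->
  1 <= x.
Proof.
move=> x0 intx hx; have [F [monF _ rootF leF]] := integral_house_poly x0 intx hx.
rewrite leNgt; apply/negP => x1.
have := @monic_int_root_norm _ F (real_complex R x) 1 monF rootF.
rewrite fmorph_eq0 gt_eqF // expr1n mulr1 lexx => /(_ isT isT) H.
have {}H : 1 <= `|real_complex R x|.
  by apply: H => z /leF /le_trans; apply; rewrite -(rmorph1 (real_complex R)) lecR ltW.
have := le_trans H (leF _ rootF).
by rewrite -(rmorph1 (real_complex R)) lecR leNgt x1.
Qed.

(** The approximation [|q_n x - p_n| <= 1 / q_(n+1)] meets the Liouville
    inequality, in which the degrees are at most [D] for [c x] and [d] for each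
    [alpha i], and conjugates are bounded by [C q_n] because [p_n <= q_n]. *)
Lemma cf_den_growth (R : realType) (d D : nat) (alpha : nat -> R)
  (d_gt0 : (0 < d)%N) (D_gt0 : (0 < D)%N)
  (alpha_gt0 : forall n, (1 <= n)%N -> 0 < alpha n)
  (alpha_int : forall n, (1 <= n)%N -> integralOver (intr : int -> R) (alpha n))
  (deg_le : forall n, (1 <= n)%N -> (alg_degree (alpha n) <= d)%N)
  (alpha_house : forall n, (1 <= n)%N ->
    `|alpha n| = house (real_complex R (alpha n))) :
  algebraicOver (ratr : rat -> R) (cont_frac alpha) ->
  (alg_degree (cont_frac alpha) <= D)%N ->
  exists2 K : R, 1 <= K & forall n, (1 <= n)%N ->
    cf_den alpha n.+1 <= (K * cf_den alpha n) ^+ (D * d ^ n).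
Proof.
move=> alg_cf deg_cf.
have a_ge1 n (n1 : (1 <= n)%N) : 1 <= alpha n.
  by apply: integral_house_ge1; auto.
have [c [F0 [h [c0 monF0 sF0 rootF0 [h1 leF0]]]]] :=
  algebraic_scaled_integral_poly alg_cf.
pose good n (F : {poly int}) := [/\ F \is monic, (size F).-1 = alg_degree (alpha n),
  root (map_poly intr F) (real_complex R (alpha n)) &
  forall z : R[i], root (map_poly intr F) z -> `|z| <= real_complex R (alpha n)].
have exF n : exists F : {poly int}, (1 <= n)%N -> good n F.
  case: n => [|n]; first by exists 0.
  have [||//|F HF] := @integral_house_poly R (alpha n.+1); auto.
  by exists F.
have [F HF] := choice exF.
pose rc := real_complex R.
pose P i := if i is 0%N then F0 else F i.
pose x i := if i is 0%N then c%:~R * rc (cont_frac alpha) else rc (alpha i).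
pose C := h + `|c|%:~R.
have cR : 1 <= `|c|%:~R :> R by rewrite ler1z -gtz0_ge1 normr_gt0.
have C1 : 1 <= C by rewrite /C (le_trans h1) // lerDl (le_trans ler01).
have C0 : 0 <= C by rewrite (le_trans ler01).
(* One factor [C] bounds the conjugates, the other absorbs [`|c|]. *)
exists (C ^+ 2) => [|n n1]; first exact: exprn_ege1.
have q1 := cf_den_ge1 n a_ge1.
have q0 := cf_den_gt0 n a_ge1.
have q0' := cf_den_gt0 n.+1 a_ge1.
have /andP[p0 pq] := cf_num_ge0_le_den n a_ge1.
have contE (d0 d1 : R) : continuant (rc d0) (rc d1) x n = rc (continuant d0 d1 alpha n).
  rewrite /rc; apply: (@rmorph_continuant _ _ (real_complex R) d0 d1 alpha x).
  by case.
have numE : cfnum x n = rc (cf_num alpha n).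
  by rewrite cf_numE /cfnum -contE /rc rmorph0 rmorph1.
have denE : cfden x n = rc (cf_den alpha n).
  by rewrite cf_denE /cfden -contE /rc rmorph1.
have [approx0 approx] := andP (cont_frac_approx a_ge1 n).
set delta := _ - _ in approx0 approx.
have betaE : cfden x n * x 0%N - c%:~R * cfnum x n = rc (c%:~R * delta).
  by rewrite numE denE /x /delta /rc !(rmorphM, rmorphB, rmorph_int) /=; ring.
pose M := cf_den alpha n * h + `|c|%:~R * cf_num alpha n.
have ME : cfden x n * rc h + `|c|%:~R * cfnum x n = rc M.
  by rewrite numE denE /M /rc rmorphD !rmorphM rmorph_int.
have M1 : 1 <= M.
  by rewrite /M -[1]addr0 lerD ?mulr_ege1 // mulr_ge0 // (le_trans ler01).
have MC : M <= C * cf_den alpha n.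
  by rewrite /M /C mulrDl [h * _]mulrC lerD2l ler_wpM2l // (le_trans ler01).
have := @continued_fraction_liouville R[i] n P x (rc h) c n1.
rewrite betaE ME /rc normr_real_complex -rmorphXn -rmorphM.
rewrite -(rmorph1 (real_complex R)) !lecR.
have beta0 : c%:~R * delta != 0 by rewrite mulf_neq0 ?intr_eq0 // -normr_gt0.
rewrite fmorph_eq0 beta0.
set N := (\prod_(i < n.+1) _)%N => /(_ _ _ _ _ isT M1) H.
have leN : (N <= D * d ^ n)%N.
  rewrite /N big_ord_recl /= sF0 leq_mul //.
  rewrite -[X in (_ <= d ^ X)%N]card_ord -prod_nat_const.
  by apply: leq_prod => i _; have [_ -> _ _] := HF i.+1 isT; apply: deg_le.
have DdS : (0 < D * d ^ n)%N by rewrite muln_gt0 D_gt0 expn_gt0 d_gt0.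
have {}H : 1 <= `|c%:~R * delta| * M ^+ N.
  apply: H.
  - by case=> [|i] _ //=; have [] := HF i.+1 isT.
  - by case=> [|i] _ //=; have [] := HF i.+1 isT.
  - exact: leF0.
  - by case=> [|i] z //= _; have [_ _ _] := HF i.+1 isT; apply.
have M0 : 0 <= M := le_trans ler01 M1.
have {}H : 1 <= C * (cf_den alpha n.+1)^-1 * (C * cf_den alpha n) ^+ (D * d ^ n).
  apply: (le_trans H); apply: ler_pM => //; first exact: exprn_ge0.
    by rewrite normrM -intr_norm ler_pM ?ler0z // /C lerDr (le_trans ler01).
  apply: (@le_trans _ _ (M ^+ (D * d ^ n))); first by rewrite ler_weXn2l.
  by rewrite lerXn2r ?nnegrE // (le_trans M0).
move: H; rewrite mulrAC ler_pdivlMr // mul1r => /le_trans; apply.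
rewrite expr2 -mulrA [leRHS]exprMn ler_wpM2r //.
  by rewrite exprn_ge0 // mulr_ge0 // ltW.
by rewrite -[leLHS]expr1 ler_weXn2l.
Qed.

(** The factor [D * d ^ i + 1] of [growth_exponent] comes from [K * q i]: one
    more factor [K * q i >= 1] absorbs the constant [K] at each step. *)
Lemma growth_exponent_bound (R : realType) (d D : nat) (q : nat -> R) (K : R) :
  1 <= K -> (forall n, 1 <= q n) ->
  (forall n, (1 <= n)%N -> q n.+1 <= (K * q n) ^+ (D * d ^ n)) ->
  forall n, (1 <= n)%N -> q n.+1 <= (K * q 1%N) ^+ growth_exponent d D n.+1.
Proof.
move=> K1 q1 leq; have K0 : 0 <= K by rewrite (le_trans ler01).
have T1 n : 1 <= K * q n by rewrite mulr_ege1.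
have T0 n : 0 <= K * q n by rewrite (le_trans ler01).
have leT n : (1 <= n)%N ->
    K * q n <= (K * q 1%N) ^+ (\prod_(1 <= i < n) (D * d ^ i + 1))%N.
  elim: n => [//|[|n] IH] _; first by rewrite big_geq // expr1.
  rewrite big_nat_recr // exprM.
  apply: (@le_trans _ _ ((K * q n.+1) ^+ (D * d ^ n.+1 + 1))).
    rewrite addn1 exprS ler_pM ?(le_trans ler01 (q1 _)) ?leq //.
    by rewrite ler_peMr.
  by rewrite lerXn2r ?nnegrE ?exprn_ge0 // IH.
case=> // n _; apply: (le_trans (leq n.+1 isT)).
rewrite /growth_exponent /= [X in _ <= _ ^+ X]mulnC [leRHS]exprM.
by rewrite lerXn2r ?nnegrE ?exprn_ge0 // leT.
Qed.

Theorem corollary2 (R : realType) (d D : nat) (alpha : nat -> R)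
  (d_gt1 : (1 < d)%N) (D_gt0 : (0 < D)%N)
  (alpha_gt0 : forall n, (1 <= n)%N -> 0 < alpha n)
  (alpha_int : forall n, (1 <= n)%N -> integralOver (intr : int -> R) (alpha n))
  (deg_le : forall n, (1 <= n)%N -> (alg_degree (alpha n) <= d)%N)
  (deg_max : exists2 n, (1 <= n)%N & alg_degree (alpha n) = d)
  (alpha_house : forall n, (1 <= n)%N ->
    `|alpha n| = house (real_complex R (alpha n)))
  (alpha_growth :
    limn_esup (fun n => (house (real_complex R (alpha n)) `^
                         (1 / (growth_exponent d D n)%:R))%:E) = +oo%E) :
  ~ (algebraicOver (ratr : rat -> R) (cont_frac alpha) /\
     (alg_degree (cont_frac alpha) <= D)%N).
Proof.
move=> [alg_cf deg_cf]; have d_gt0 := ltnW d_gt1.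
have a_ge1 n (n1 : (1 <= n)%N) : 1 <= alpha n.
  by apply: integral_house_ge1; auto.
have [K K1 leK] := cf_den_growth d_gt0 D_gt0 alpha_gt0 alpha_int deg_le
  alpha_house alg_cf deg_cf.
have leq := growth_exponent_bound K1 (fun n => cf_den_ge1 n a_ge1) leK.
set B := K * _ in leq.
have B0 : 0 <= B by rewrite mulr_ge0 ?(le_trans ler01) ?cf_den_ge1.
move: alpha_growth; set u := (u in limn_esup u) => alpha_growth.
suff : (limn_esup u <= B%:E)%E by rewrite alpha_growth.
apply: ge_ereal_inf.
exists (ereal_sup (u @` [set n | (2 <= n)%N])).
  by exists [set n | (2 <= n)%N] => //; exists 2%N.
apply: ge_ereal_sup => _ [[//|[//|n]] _ <-]; rewrite lee_fin.
rewrite -alpha_house // gtr0_norm ?alpha_gt0 //.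
have g0 : (0 < growth_exponent d D n.+2)%N.
  rewrite /growth_exponent !muln_gt0 D_gt0 expn_gt0 d_gt0 /=.
  by rewrite prodn_gt0 // => i; rewrite addn1.
have le_alpha : alpha n.+2 <= B ^+ growth_exponent d D n.+2.
  apply: le_trans (leq n.+1 isT); rewrite cf_denSS.
  have a0 := alpha_gt0 n.+2 isT.
  have q1 := cf_den_ge1 n.+1 a_ge1.
  rewrite -[leLHS]addr0 lerD //; first by rewrite ler_peMr // ltW.
  exact/ltW/cf_den_gt0.
have -> : B = (B ^+ growth_exponent d D n.+2) `^ (1 / (growth_exponent d D n.+2)%:R).
  rewrite -powR_mulrn // -powRrM mulrC divfK ?powRr1 //.
  by rewrite pnatr_eq0 -lt0n.
rewrite ge0_ler_powR ?nnegrE ?exprn_ge0 ?divr_ge0 ?ler01 //.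
by rewrite ltW // alpha_gt0.
Qed.
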